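(* Let $x_1^0<\dots<x_N^0$ be real numbers, let $w_1,\dots,w_N\ge 0$ with $0<\sum_{i=1}^N w_i\le 1$, and let $D=\{\boldsymbol x\in\mathbb R^N: x_i<x_j \text{ whenever } i<j\}$. There exists a unique solution $\boldsymbol x=(x_1,\dots,x_N):\mathbb R^+\to D$ of the system $$\dot x_i(t)=\Big(\sum_{j=1}^N w_jK(x_i(t)-x_j(t))\Big)^2\sum_{\substack{j=1\\ j\ne i}}^N w_jK'''(x_i(t)-x_j(t)),\qquad x_i(0)=x_i^0,\qquad i=1,\dots,N.$$ Therefore (and equivalently), with $M=\{x_1^0,\dots,x_N^0\}$ and $\mu=\sum_{i=1}^N w_i\delta_{x_i^0}$, the map $c\in I_M$ given by $c(x_i^0,t)=x_i(t)$, $t\in\mathbb R^+$, $1\le i\le N$, is the unique solution in $I_M$ of $$c_t(x,t)=H(c,x,t)^2\int_{z\ne x}K'''(c(x,t)-c(z,t))\,d\mu(z),\qquad c(x,0)=x,\qquad (x,t)\in M\times(0,\infty).$$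
   Context: $\mathbb R^+=[0,\infty)$. $\alpha>0$ is a fixed constant and $K(x)=\frac1{4\alpha^2}(\alpha+|x|)e^{-|x|/\alpha}$; $K'''$ is its classical third derivative, defined on $\mathbb R\setminus\{0\}$. For finite $M\subset\mathbb R$, $I_M$ is the set of locally bounded functions $c:M\times\mathbb R^+\to\mathbb R$ such that $c(\cdot,t)$ is Borel measurable for all $t\in\mathbb R^+$, $c(x,\cdot)$ is $C^1$ for all $x\in M$, and $c(x,t)<c(y,t)$ for all $t\in\mathbb R^+$ and all $x,y\in M$ with $x<y$. $H(c,x,t)=\int_{-\infty}^\infty K(c(x,t)-c(z,t))\,d\mu(z)$. *)

(* Defs.v *)
From HB Require Import structures.
From mathcomp Require Import all_boot all_order all_algebra.
From mathcomp Require Import all_classical all_reals all_analysis.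

Set Implicit Arguments.
Unset Strict Implicit.
Unset Printing Implicit Defensive.

Import Order.TTheory GRing.Theory Num.Theory.
Import numFieldNormedType.Exports.

Local Open Scope classical_set_scope.
Local Open Scope ring_scope.

(* [0, +oo[. Functions on it are represented by functions on R of which only
   the values at t >= 0 are relevant. *)
Definition Rplus (R : realType) : set R := [set t | 0 <= t].
Arguments Rplus {R}.

(* The derivative at t of the restriction of f to A is l; for A = Rplus this
   is the two-sided derivative at t > 0 and the right derivative at 0. *)
Definition is_derive_within (R : realType) (A : set R) (f : R -> R) (t l : R) :=
  (s - t)^-1 * (f s - f t) @[s --> within A t^'] --> l.

Definition C1_on (R : realType) (A : set R) (f : R -> R) :=
  exists df : R -> R, {within A, continuous df} /\
    forall t, A t -> is_derive_within A f t (df t).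

Definition Kfun (R : realType) (alpha x : R) : R :=
  (4 * alpha ^+ 2)^-1 * (alpha + `|x|) * expR (- (`|x| / alpha)).

(* The iterated library derivative takes a junk value at 0, where the third
   derivative does not exist; it is only evaluated at nonzero arguments. *)
Definition Kfun3 (R : realType) (alpha : R) : R -> R :=
  derive1n 3 (Kfun alpha).

Definition increasing_config (R : realType) (N : nat) : set 'rV[R]_N :=
  [set x | forall i j : 'I_N, (i < j)%N -> x ord0 i < x ord0 j].
Arguments increasing_config {R N}.

Definition ode_rhs (R : realType) (alpha : R) (N : nat)
    (w : 'I_N -> {nonneg R}) (x : 'rV[R]_N) (i : 'I_N) : R :=
  (\sum_(j < N) (w j)%:num * Kfun alpha (x ord0 i - x ord0 j)) ^+ 2 *
  \sum_(j < N | j != i) (w j)%:num * Kfun3 alpha (x ord0 i - x ord0 j).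

Definition ode_solution (R : realType) (alpha : R) (N : nat)
    (w : 'I_N -> {nonneg R}) (x0 : 'rV[R]_N) (x : R -> 'rV[R]_N) :=
  [/\ forall t, Rplus t -> increasing_config (x t),
      x 0 = x0 &
      forall t i, Rplus t ->
        is_derive_within Rplus (fun s => x s ord0 i) t
          (ode_rhs alpha w (x t) i)].

(* A map M x Rplus -> R is represented by a map c : R -> R -> R of which only
   the values c x t with M x and t >= 0 are relevant. *)
Definition I_ (R : realType) (M : set R) : set (R -> R -> R) :=
  [set c : R -> R -> R | [/\ [locally [bounded c q.1 q.2 | q in M `*` Rplus]],
               forall t, Rplus t -> measurable_fun M (c ^~ t),
               forall x, M x -> C1_on Rplus (c x) &
               forall t x y, Rplus t -> M x -> M y -> x < y ->
                 c x t < c y t]].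

(* As c is only meaningful on M, integrals against mu, which is concentrated
   on M, are taken over M. *)
Definition H_ (R : realType) (alpha : R) (M : set R)
    (mu : {measure set R -> \bar R}) (c : R -> R -> R) (x t : R) : R :=
  \int[mu]_(z in M) Kfun alpha (c x t - c z t).

Definition pde_solution (R : realType) (alpha : R) (M : set R)
    (mu : {measure set R -> \bar R}) (c : R -> R -> R) :=
  (forall x t : R, M x -> 0 < t ->
    is_derive t 1 (c x)
      (H_ alpha M mu c x t ^+ 2 *
       \int[mu]_(z in M `\ x) Kfun3 alpha (c x t - c z t))) /\
  (forall x, M x -> c x 0 = x).

Section weighted_dirac.
Local Open Scope ereal_scope.
Variables (R : realType) (N : nat) (w : 'I_N -> {nonneg R}) (a : 'rV[R]_N).

Definition weighted_dirac (A : set R) : \bar R :=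
  \sum_(i < N) mscale (w i) \d_(a ord0 i) A.

Let weighted_dirac0 : weighted_dirac set0 = 0.
Proof. by rewrite /weighted_dirac big1. Qed.

Let weighted_dirac_ge0 B : 0 <= weighted_dirac B.
Proof. by rewrite /weighted_dirac; apply: sume_ge0. Qed.

Let weighted_dirac_sigma_additive : semi_sigma_additive weighted_dirac.
Proof.
move=> F mF tF mUF; rewrite [X in _ --> X](_ : _ =
    lim ((fun n => \sum_(0 <= i < n) weighted_dirac (F i)) @ \oo)).
  by apply: is_cvg_ereal_nneg_natsum => k _; exact: weighted_dirac_ge0.
rewrite nneseries_sum//; apply: eq_bigr => /= i _.
exact: measure_semi_bigcup.
Qed.

HB.instance Definition _ := isMeasure.Build _ _ _ weighted_dirac
  weighted_dirac0 weighted_dirac_ge0 weighted_dirac_sigma_additive.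

End weighted_dirac.

(* Main.v *)
Require Import Defs.
From HB Require Import structures.
From mathcomp Require Import all_boot all_order all_algebra.
From mathcomp Require Import all_classical all_reals all_analysis.
From mathcomp Require Import ring lra.

(* Away from 0, K''' is sgn times an even kernel k that is bounded and globally
   Lipschitz, with k(0) >= 0. On increasing configurations sgn(x_i - x_j) depends
   only on i and j, so the right-hand side of the system coincides with a bounded
   and globally Lipschitz vector field on R^N, whose flow exists for all times and
   is unique by Picard iteration. Along this flow neighbours i and j = i + 1 are
   seen by all other particles with the same signs, and their mutual interaction
   is repulsive up to an error O(|x_j - x_i|), because k(x) >= k(0) - C|x|; hence
   the gap g = x_j - x_i satisfies g' >= -C|g| and stays positive. The flow thus
   remains increasing and solves the original system. The equation for c is the
   same system, because integrals against mu are finite sums; the equation at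
   t = 0 is recovered from t > 0 by continuity of the derivative. *)

Set Implicit Arguments.
Unset Strict Implicit.
Unset Printing Implicit Defensive.

Import Order.TTheory GRing.Theory Num.Theory.
Import numFieldNormedType.Exports.

Local Open Scope classical_set_scope.
Local Open Scope ring_scope.

(** * Derivatives on the half line *)

Lemma RplusE (R : realType) : @Rplus R = [set` `[0, +oo[%R].
Proof. by apply/seteqP; split=> t /=; rewrite in_itv/= andbT. Qed.

Section half_line_derivatives.
Variable R : realType.
Implicit Types f g d : R -> R.

(** Differentiability is asked only at positive times, where the derivative is two-sided. Continuity
    up to 0 is what monotonicity arguments need at the endpoint. *)
Definition half_line_derive f d :=
  {within Rplus, continuous f} /\ forall t : R, 0 < t -> is_derive t 1 f (d t).

Lemma within_Rplus_dnbhs (t : R) : 0 < t -> within Rplus t^' = t^'.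
Proof.
move=> t0; apply/seteqP; split=> P; last exact: cvg_within.
rewrite /within/= => HP.
have : \forall s \near t^', Rplus s.
  apply: nbhs_dnbhs; change (nbhs t Rplus).
  by near=> s; rewrite /Rplus/=; apply: ltW; near: s; exact: lt_nbhsr.
by apply: filterS2 HP => s; exact.
Unshelve. all: by end_near. Qed.

(** Translating by [t] turns the quotients in an increment tending to 0, used by the library
    derivative, into the quotients in [s] tending to [t], used by [is_derive_within]. *)
Lemma is_derive_cvgP f (t l : R) :
  is_derive t 1 f l <-> (s - t)^-1 * (f s - f t) @[s --> t^'] --> l.
Proof.
have E : h^-1 *: ((f \o shift t) (h *: 1) - f t) @[h --> 0^'] =
         (s - t)^-1 * (f s - f t) @[s --> t^'].
  apply/seteqP; split=> P.
    change ((\forall h \near (0 : R), h != 0 ->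
        P (h^-1 *: ((f \o shift t) (h *: 1) - f t))) ->
      \forall s \near t, s != t -> P ((s - t)^-1 * (f s - f t))).
    rewrite (near_shift 0 t) subr0; apply: filterS => h /= + ht.
    have h0 : h != 0 by rewrite -(subr_eq0 _ t) addrK in ht.
    by move=> /(_ h0); rewrite addrK [h *: 1]mulr1.
  change ((\forall s \near t, s != t -> P ((s - t)^-1 * (f s - f t))) ->
    \forall h \near (0 : R), h != 0 ->
        P (h^-1 *: ((f \o shift t) (h *: 1) - f t))).
  rewrite (near_shift 0 t) subr0; apply: filterS => h /= + ht.
  have h0 : h + t != t by rewrite -(subr_eq0 _ t) addrK.
  by move=> /(_ h0); rewrite addrK [h *: 1]mulr1.
split=> [[fd <-]|fl].
  by rewrite -E; exact: fd.
by rewrite -E in fl; split; [apply/cvg_ex; exists l|exact: cvg_lim fl].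
Qed.

Lemma is_derive_within_eq (A : set R) f g (t l : R) :
  {in A, f =1 g} -> A t -> is_derive_within A f t l -> is_derive_within A g t l.
Proof.
move=> fg At; apply: cvg_trans; apply: near_eq_cvg.
rewrite near_withinE; apply: nearW => s As.
by rewrite !fg// inE.
Qed.

Lemma is_derive_within_gt0 f (t l : R) : 0 < t ->
  is_derive_within Rplus f t l <-> is_derive t 1 f l.
Proof.
by move=> t0; rewrite /is_derive_within within_Rplus_dnbhs// is_derive_cvgP.
Qed.

Lemma is_derive_is_derive_within (A : set R) f (t l : R) :
  is_derive t 1 f l -> is_derive_within A f t l.
Proof.
by move=> /is_derive_cvgP; apply: cvg_trans; apply: cvg_app; exact: cvg_within.
Qed.

Lemma is_derive_within_continuous (A : set R) f d :
  (forall t, A t -> is_derive_within A f t (d t)) -> {within A, continuous f}.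
Proof.
move=> fd; apply/subspace_continuousP => t At; apply/cvgrPdist_lt => e e0.
(* Once the quotients are within 1 of [d t], the increment of [f] is at most $(|d(t)|+1)|s-t|$. *)
have /cvgrPdist_lt/(_ 1 ltr01) := fd _ At.
rewrite near_withinE => H.
have C0 : 0 < `|d t| + 1 by rewrite ltr_wpDl.
have eC : 0 < e / (`|d t| + 1) by rewrite divr_gt0.
have : \forall s \near t, s != t -> A s ->
    `|d t - (s - t)^-1 * (f s - f t)| < 1 by exact: H.
apply: filterS2 (near_ball t _ eC) => s.
rewrite -ball_normE/= => ts q As.
have [->|st] := eqVneq s t; first by rewrite subrr normr0.
have := q st As; set k := _^-1 * _ => dk.
have fk : f s - f t = (s - t) * k by rewrite mulVKf// subr_eq0.
rewrite distrC fk normrM distrC.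
move: ts; rewrite ltr_pdivlMr//; apply: le_lt_trans.
rewrite ler_wpM2l//.
have := ler_normD (d t) (k - d t); rewrite addrCA subrr addr0.
move=> /le_trans; apply.
by rewrite lerD2l distrC ltW.
Qed.

Lemma half_line_derive_within f d :
  (forall t, Rplus t -> is_derive_within Rplus f t (d t)) ->
  half_line_derive f d.
Proof.
move=> fd; split; first exact: is_derive_within_continuous fd.
by move=> t t0; apply/is_derive_within_gt0 => //; apply: fd; exact: ltW.
Qed.

Lemma lipschitz_within_continuous (A : set R) f (C : R) :
  (forall s t, A s -> A t -> `|f s - f t| <= C * `|s - t|) ->
  {within A, continuous f}.
Proof.
move=> fC; apply/subspace_continuousP => t At; apply/cvgrPdist_lt => e e0.
have C0 : 0 < `|C| + 1 by rewrite ltr_wpDl.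
have eC : 0 < e / (`|C| + 1) by rewrite divr_gt0.
rewrite near_withinE; apply: filterS (near_ball t _ eC) => s.
rewrite -ball_normE/= ltr_pdivlMr// => ts As.
apply: le_lt_trans (fC _ _ At As) _; apply: le_lt_trans ts.
by rewrite mulrC ler_wpM2l// (le_trans (ler_norm C))// lerDl.
Qed.

Lemma half_line_derive_ndecr f d : half_line_derive f d ->
  (forall t, 0 < t -> 0 <= d t) ->
  forall s t, 0 <= s -> s <= t -> f s <= f t.
Proof.
move=> [cf df] d0 s t s0 st.
apply: (@ger0_derive1_ndecry R f 0) => //.
- by move=> x; rewrite in_itv/= andbT => /df [].
- move=> x; rewrite in_itv/= andbT => x0; rewrite derive1E.
  by have /@derive_val -> := df _ x0; exact: d0.
- by rewrite -RplusE.
Qed.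

Lemma half_line_deriveD f g d e :
  half_line_derive f d -> half_line_derive g e ->
  half_line_derive (f \+ g) (d \+ e).
Proof.
move=> [cf df] [cg dg]; split=> [t|t t0].
  by apply: continuousD; [exact: cf|exact: cg].
by have ? := df _ t0; have ? := dg _ t0; exact: is_deriveD.
Qed.

Lemma half_line_deriveN f d : half_line_derive f d ->
  half_line_derive (fun t => - f t) (fun t => - d t).
Proof.
move=> [cf df]; split=> [t|t t0]; first by apply: continuousN; exact: cf.
by have ? := df _ t0; exact: is_deriveN.
Qed.

Lemma half_line_derive_le f g d e :
  half_line_derive f d -> half_line_derive g e ->
  (forall t, 0 < t -> d t <= e t) ->
  forall s t, 0 <= s -> s <= t -> f t - f s <= g t - g s.
Proof.
move=> fd ge de s t s0 st.
have /(_ _ s t s0 st) := half_line_derive_ndecr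
  (half_line_deriveD ge (half_line_deriveN fd)).
move=> /= H; rewrite -subr_ge0.
have -> : g t - g s - (f t - f s) = g t - f t - (g s - f s) by ring.
by rewrite subr_ge0; apply: H => u u0; rewrite subr_ge0; exact: de.
Qed.

(** Comparison with [g] is applied to [f] and to [- f]. This mean value inequality takes the place
    of integral estimates in the Picard iteration. *)
Lemma half_line_derive_norm_le f g d e :
  half_line_derive f d -> half_line_derive g e ->
  (forall t, 0 < t -> `|d t| <= e t) ->
  forall s t, 0 <= s -> s <= t -> `|f t - f s| <= g t - g s.
Proof.
move=> fd ge de s t s0 st; rewrite ler_norml; apply/andP; split.
  have := half_line_derive_le (half_line_deriveN fd) ge _ s0 st.
  rewrite opprK lerNl opprB addrC; apply => u u0.
  by apply: le_trans (de _ u0); rewrite -normrN ler_norm.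
apply: (half_line_derive_le fd ge _ s0 st) => u u0.
by apply: le_trans (de _ u0); exact: ler_norm.
Qed.

Lemma is_derive_half_line f d :
  (forall t : R, 0 <= t -> is_derive t 1 f (d t)) -> half_line_derive f d.
Proof.
move=> fd; apply: half_line_derive_within => t t0.
by apply: is_derive_is_derive_within; exact: fd.
Qed.

Lemma half_line_derive_scale (C : R) : half_line_derive ( *%R C) (cst C).
Proof.
apply: is_derive_half_line => t _.
have := @is_deriveZ R R R id C t 1 1 (is_derive_id _ _).
by rewrite [C *: 1]mulr1.
Qed.

Lemma half_line_derive_expR (C L : R) :
  half_line_derive (fun t => C * expR (L * t)) (fun t => C * L * expR (L * t)).
Proof.
apply: is_derive_half_line => t _.
have dL : is_derive t 1 ( *%R L) L.
  have := @is_deriveZ R R R id L t 1 1 (is_derive_id _ _).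
  by rewrite [L *: 1]mulr1.
have dE := @is_derive1_comp R expR ( *%R L) t _ _ (is_derive_expR _) dL.
have := @is_deriveZ R R R _ C t 1 _ dE.
by rewrite [C *: _]mulrA mulrAC.
Qed.

Lemma half_line_derive_lipschitz f d (C : R) : half_line_derive f d ->
  (forall t, 0 < t -> `|d t| <= C) ->
  forall s t, 0 <= s -> 0 <= t -> `|f s - f t| <= C * `|s - t|.
Proof.
move=> fd dC; have H s t : 0 <= s -> s <= t -> `|f t - f s| <= C * (t - s).
  rewrite mulrBr.
  exact: half_line_derive_norm_le (half_line_derive_scale C) dC _ _.
move=> s t s0 t0; have [st|/ltW ts] := leP s t.
  by rewrite distrC [`|s - t|]distrC [`|t - s|]ger0_norm ?subr_ge0 ?H.
by rewrite [`|s - t|]ger0_norm ?subr_ge0 ?H.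
Qed.

End half_line_derivatives.

(** * Picard iteration for bounded Lipschitz systems *)

Section primitive.
Variable R : realType.
Implicit Types h : R -> R.

(* The lower bound -1 makes the primitive two-sided differentiable at 0. *)
Definition primitive h (t : R) : R :=
  \int[lebesgue_measure]_(u in `[(-1 : R), t]) h u -
  \int[lebesgue_measure]_(u in `[(-1 : R), 0]) h u.

Lemma primitive0 h : primitive h 0 = 0.
Proof. exact: subrr. Qed.

Lemma is_derive_primitive h (t : R) : continuous h -> 0 <= t ->
  is_derive t 1 (primitive h) (h t).
Proof.
move=> ch t0.
(* The interval from -1 to [t + 1] has [t] in its interior, also when [t] is 0. *)
have [] := @continuous_FTC1_closed R h (-1) t (t + 1).
- by rewrite ltrDl.
- apply: continuous_compact_integrable; first exact: segment_compact.
  exact: continuous_subspaceT.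
- by apply: lt_le_trans t0; rewrite oppr_lt0.
- exact: ch.
move=> dI; rewrite derive1E => I.
have dI' := DeriveDef dI I.
have := @is_deriveB R R R _ _ t 1 _ _ dI' (is_derive_cst
  (\int[lebesgue_measure]_(u in `[(-1 : R), 0]) h u) t 1).
by rewrite subr0.
Qed.

End primitive.

Section geometric.
Variable R : realType.

Lemma le0_of_geometric_bound (a C : R) : (forall n, a <= C / 2 ^+ n) -> a <= 0.
Proof.
move=> aC.
have : C / 2 ^+ n @[n --> \oo] --> (0 : R).
  rewrite -(mulr0 C).
  under eq_fun do rewrite -exprVn.
  apply: cvgM; first exact: cvg_cst.
  by apply: cvg_expr; rewrite ger0_norm ?invf_lt1 ?ltr1n// invr_ge0.
by move=> /cvgr_to_ge; apply; exact: nearW.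
Qed.

(* Subtracting (adding) the tail of the geometric series makes the sequence
   nondecreasing (nonincreasing); the limit is the supremum of the former. *)
Lemma geometric_limit (u : nat -> R) (C : R) :
  (forall n, `|u n.+1 - u n| <= C / 2 ^+ n) ->
  exists l, forall n, `|u n - l| <= 2 * C / 2 ^+ n.
Proof.
(* [r n] is the tail of the series of bounds, the sum of $C/2^k$ over $k\ge n$. *)
move=> uC; pose r n : R := 2 * C / 2 ^+ n.
have rS n : r n.+1 = r n - C / 2 ^+ n by rewrite /r exprS; field.
have r0 n : 0 <= r n.
  by rewrite /r -mulrA mulr_ge0// (le_trans _ (uC n)).
have mono : {homo (fun n => u n - r n) : n m / (n <= m)%N >-> n <= m}.
  apply: homo_leq => [n //|n m p|n]; first exact: le_trans.
  by have := uC n; rewrite rS ler_norml => /andP[]; lra.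
have antimono : {homo (fun n => u n + r n) : n m / (n <= m)%N >-> m <= n}.
  apply: homo_leq => [n //|n m p mn pn|n]; first exact: le_trans pn mn.
  by have := uC n; rewrite rS ler_norml => /andP[]; lra.
have ab n m : u n - r n <= u m + r m.
  have := mono _ _ (leq_maxl n m); have := antimono _ _ (leq_maxr n m).
  by move=> /=; have := r0 (maxn n m); lra.
exists (sup (range (fun n => u n - r n))) => n.
have H : has_sup (range (fun n => u n - r n)).
  by split; [exists (u 0%N - r 0%N), 0%N|exists (u 0%N + r 0%N) => _ [m _ <-]].
have le_l : u n - r n <= sup (range (fun n => u n - r n)).
  by apply: ub_le_sup; [exact: H.2|exists n].
have l_le : sup (range (fun n => u n - r n)) <= u n + r n.
  by apply: ge_sup; [exact: H.1|move=> _ [m _ <-]].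
by rewrite -/(r n) ler_norml; apply/andP; split; lra.
Qed.

End geometric.

Section picard.
Variables (R : realType) (I : Type) (F : (I -> R) -> I -> R) (B L : R).
Hypothesis L0 : 0 < L.
Hypothesis F_bounded : forall x i, `|F x i| <= B.
Hypothesis F_lipschitz : forall (x y : I -> R) (e : R),
  (forall i, `|x i - y i| <= e) -> forall i, `|F x i - F y i| <= L * e.

(* Measured against the weight [expR (2 * L * t)], the Picard operator is
   a contraction of ratio 1/2. *)
Lemma picard_contraction (u v p q : R -> I -> R) (C : R) :
  (forall i, half_line_derive (u ^~ i) (fun t => F (p t) i)) ->
  (forall i, half_line_derive (v ^~ i) (fun t => F (q t) i)) ->
  u 0 = v 0 ->
  (forall (t : R) i, 0 <= t -> `|p t i - q t i| <= C * expR (2 * L * t)) ->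
  forall (t : R) i, 0 <= t -> `|u t i - v t i| <= C / 2 * expR (2 * L * t).
Proof.
move=> du dv uv0 pq t i t0.
have C0 : 0 <= C.
  by have := pq 0 i (lexx _); rewrite mulr0 expR0 mulr1; apply: le_trans.
(* The comparison function $\frac C2 e^{2Lt}$ has derivative $L\,Ce^{2Lt}$, exactly the Lipschitz
   bound for the difference of the right-hand sides. Its value at 0 is discarded at the end. *)
have := half_line_derive_norm_le
  (half_line_deriveD (du i) (half_line_deriveN (dv i)))
  (half_line_derive_expR (C / 2) (2 * L)) _ (lexx 0) t0.
rewrite /= uv0 subrr subr0 mulr0 expR0 mulr1 => H.
apply: le_trans (H _) _ => [s s0|]; last by rewrite lerBlDr lerDl divr_ge0.
apply: le_trans (F_lipschitz _ i) _ => [j|]; first exact: pq (ltW s0).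
by rewrite le_eqVlt; apply/orP; left; apply/eqP; field.
Qed.

Let B_ge0 (i : I) : 0 <= B.
Proof. by apply: le_trans (F_bounded (fun=> 0) i). Qed.

(** A solution drives its own Picard step, so [picard_contraction] with [p = u] and [q = v] halves
    the weighted distance of two solutions as often as desired. *)
Lemma bounded_ode_uniqueness (u v : R -> I -> R) :
  (forall i, half_line_derive (u ^~ i) (fun t => F (u t) i)) ->
  (forall i, half_line_derive (v ^~ i) (fun t => F (v t) i)) ->
  u 0 = v 0 -> forall t : R, 0 <= t -> u t = v t.
Proof.
move=> du dv uv0 t t0; apply/funext => i.
have H n (s : R) j : 0 <= s ->
    `|u s j - v s j| <= B / L / 2 ^+ n * expR (2 * L * s).
  elim: n s j => [|n IHn] s j s0.
    have B0 := B_ge0 i.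
    have := half_line_derive_norm_le
      (half_line_deriveD (du j) (half_line_deriveN (dv j)))
      (half_line_derive_scale (2 * B)) _ (lexx 0) s0.
    rewrite /= uv0 subrr subr0 mulr0 subr0 expr0 divr1 => H.
    apply: le_trans (H _) _ => [r r0|].
      apply: le_trans (ler_normB _ _) _.
      by rewrite mulr_natl mulr2n lerD.
    (* The crude linear bound is absorbed by the weight, since $2Ls\le e^{2Ls}$. *)
    have -> : 2 * B * s = B / L * (2 * L * s) by field; rewrite gt_eqF.
    rewrite ler_wpM2l ?divr_ge0 ?(ltW L0)//.
    by apply: le_trans (expR_ge1Dx _); rewrite lerDr.
  have := picard_contraction du dv uv0 IHn j s0.
  by congr (_ <= _ * _); rewrite exprSr; field; rewrite expf_neq0// gt_eqF.
apply/eqP; rewrite -subr_eq0 -normr_le0.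
apply: (@le0_of_geometric_bound _ _ (B / L * expR (2 * L * t))) => n.
by rewrite mulrAC; exact: H.
Qed.

Section existence.
Variable x0 : I -> R.

(** Replacing [s] by [Num.max s 0] freezes [y] at negative times, so that the integrand is
    continuous on the whole line. *)
Definition picard (y : R -> I -> R) (t : R) (i : I) : R :=
  x0 i + primitive (fun s => F (y (Num.max s 0)) i) t.

(** This is the invariant of the iteration: it makes the integrand of the next iterate continuous,
    and it survives pointwise limits. *)
Definition half_line_lipschitz (y : R -> I -> R) := forall (s t : R) i,
  0 <= s -> 0 <= t -> `|y s i - y t i| <= B * `|s - t|.

Lemma picard0 y : picard y 0 = x0.
Proof. by apply/funext => i; rewrite /picard primitive0 addr0. Qed.

Lemma is_derive_picard y i (t : R) : half_line_lipschitz y -> 0 <= t ->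
  is_derive t 1 (picard y ^~ i) (F (y t) i).
Proof.
move=> ly t0.
have ch : continuous (fun s : R => F (y (Num.max s 0)) i).
  move=> s; apply/cvgrPdist_lt => e e0.
  have BL : 0 < B * L + 1.
    by rewrite ltr_wpDl// mulr_ge0 ?(B_ge0 i)// ltW.
  have eC : 0 < e / (B * L + 1) by rewrite divr_gt0.
  apply: filterS (near_ball s _ eC) => r.
  rewrite -ball_normE/= ltr_pdivlMr// => sr.
  apply: le_lt_trans sr.
  (* Truncation at 0 is 1-Lipschitz, hence the integrand is Lipschitz with constant [B * L]. *)
  have mm : `|Num.max s 0 - Num.max r 0| <= `|s - r|.
    have [s0|s0] := leP s 0; have [r0|r0] := leP r 0.
    - by rewrite subrr normr0.
    - by rewrite sub0r normrN distrC !ger0_norm; lra.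
    - by rewrite subr0 !ger0_norm; lra.
    - by [].
  apply: le_trans (F_lipschitz (e := B * `|s - r|) _ i) _ => [j|].
    apply: le_trans (ly _ _ _ _ _) _; rewrite ?le_max ?lexx ?orbT//.
    by rewrite ler_wpM2l// (B_ge0 i).
  by rewrite -subr_ge0 (_ : _ - _ = `|s - r|) //; ring.
have := @is_derive_primitive R _ t ch t0; rewrite max_l// => dP.
have := @is_deriveD R R R (cst (x0 i)) _ t 1 _ _ (is_derive_cst _ _ _) dP.
by rewrite add0r.
Qed.

Lemma picard_lipschitz y :
  half_line_lipschitz y -> half_line_lipschitz (picard y).
Proof.
move=> ly s t i s0 t0.
have dy : half_line_derive (picard y ^~ i) (fun r => F (y r) i).
  by apply: is_derive_half_line => r r0; exact: is_derive_picard.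
by apply: (half_line_derive_lipschitz dy) => // r _; exact: F_bounded.
Qed.

(** The iterates started at the constant [x0] converge geometrically in the weighted distance. The
    limit inherits the Lipschitz bound, and one more contraction identifies it with its own Picard
    image. *)
Lemma bounded_ode_existence : exists x : R -> I -> R, x 0 = x0 /\
  forall i (t : R), 0 <= t -> is_derive t 1 (x ^~ i) (F (x t) i).
Proof.
pose X n := iter n picard (fun=> x0).
have lX n : half_line_lipschitz (X n).
  elim: n => [s t i _ _|n]; last exact: picard_lipschitz.
  by rewrite subrr normr0 mulr_ge0// (B_ge0 i).
have dX n i : half_line_derive (X n.+1 ^~ i) (fun t => F (X n t) i).
  by apply: is_derive_half_line => t t0; exact: is_derive_picard.
have X0 n : X n 0 = x0 by case: n => [//|n]; exact: picard0.
have step n (t : R) i : 0 <= t ->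
    `|X n.+1 t i - X n t i| <= B / (2 * L) / 2 ^+ n * expR (2 * L * t).
  elim: n t i => [|n IHn] t i t0.
    have := lX 1%N t 0 i t0 (lexx 0); rewrite X0 => /le_trans; apply.
    rewrite subr0 ger0_norm// expr0 divr1.
    have -> : B * t = B / (2 * L) * (2 * L * t) by field; rewrite gt_eqF.
    rewrite ler_wpM2l ?divr_ge0 ?mulr_ge0 ?(B_ge0 i) ?(ltW L0)//.
    by apply: le_trans (expR_ge1Dx _); rewrite lerDr.
  have X00 : X n.+2 0 = X n.+1 0 by rewrite !X0.
  have := picard_contraction (dX n.+1) (dX n) X00 IHn i t0.
  by congr (_ <= _ * _); rewrite exprSr; field; rewrite expf_neq0// gt_eqF.
pose C t : R := B / (2 * L) * expR (2 * L * t).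
(* The limit is chosen separately at each time; its values at negative times carry no
   information. *)
have /choice[x Hx] : forall t, exists y : I -> R, 0 <= t ->
    forall i n, `|X n t i - y i| <= 2 * C t / 2 ^+ n.
  move=> t; have [t0|t0] := boolP (0 <= t); last by exists x0.
  have /choice[y Hy] : forall i, exists l, forall n,
      `|X n t i - l| <= 2 * C t / 2 ^+ n.
    by move=> i; apply: geometric_limit => n; rewrite /C mulrAC; exact: step.
  by exists y.
have lx : half_line_lipschitz x.
  move=> s t i s0 t0; rewrite -subr_le0.
  apply: (@le0_of_geometric_bound _ _ (2 * C s + 2 * C t)) => n.
  have := Hx s s0 i n; have := Hx t t0 i n; have := lX n s t i s0 t0.
  rewrite [(_ + _) / _]mulrDl lerBlDr.
  have -> : x s i - x t i = - (X n s i - x s i) + (X n t i - x t i)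
     + (X n s i - X n t i) by ring.
  move=> h1 h2 h3; apply: le_trans (ler_normD _ _) _; apply: lerD => //.
  by apply: le_trans (ler_normD _ _) _; apply: lerD => //; rewrite normrN.
have dPx i : half_line_derive (picard x ^~ i) (fun t => F (x t) i).
  by apply: is_derive_half_line => t t0; exact: is_derive_picard.
have fix_x (t : R) : 0 <= t -> picard x t = x t.
  move=> t0; apply/funext => i; apply/eqP; rewrite -subr_eq0 -normr_le0.
  pose D := B / (2 * L).
  apply: (@le0_of_geometric_bound _ _ (2 * C t)) => n.
  have Xx (s : R) j : 0 <= s ->
      `|X n s j - x s j| <= 2 * D / 2 ^+ n * expR (2 * L * s).
    by move=> s0; have := Hx s s0 j n; rewrite /C -/D mulrA mulrAC.
  have X00 : X n.+1 0 = picard x 0 by rewrite X0 picard0.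
  have h1 := picard_contraction (dX n) dPx X00 Xx i t0.
  have h2 := Hx t t0 i n.+1.
  have -> : picard x t i - x t i =
    - (X n.+1 t i - picard x t i) + (X n.+1 t i - x t i) by ring.
  apply: le_trans (ler_normD _ _) _; rewrite normrN.
  apply: le_trans (lerD h1 h2) _; rewrite /C -/D exprS.
  by rewrite le_eqVlt; apply/orP; left; apply/eqP; field; rewrite expf_neq0.
(* The witness is [picard x] rather than [x]: both agree for [0 <= t], but only the former is
   controlled to the left of 0, as a two-sided derivative at 0 demands. *)
exists (picard x); split=> [|i t t0]; first exact: picard0.
by rewrite fix_x//; exact: is_derive_picard.
Qed.

End existence.

End picard.

(** * The kernels *)

Section damped.
Variables (R : realType) (alpha : R).
Hypothesis alpha_gt0 : 0 < alpha.

(** This family contains $K$ and, away from 0 and up to a factor sgn, is closed under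
    differentiation, which acts linearly on the pair [(a, b)]. *)
Definition damped (a b x : R) : R := (a + b * `|x|) * expR (- (`|x| / alpha)).

Lemma sgr_near (x : R) : x != 0 -> \forall y \near x, Num.sg y = Num.sg x.
Proof.
rewrite neq_lt => /orP[x0|x0]; near=> y.
  by rewrite !ltr0_sg//; near: y; exact: lt_nbhsl.
by rewrite !gtr0_sg//; near: y; exact: lt_nbhsr.
Unshelve. all: by end_near. Qed.

Lemma near_neq0 (x : R) : x != 0 -> \forall y \near x, y != 0.
Proof.
by move=> x0; apply: filterS (sgr_near x0) => y sy; rewrite -sgr_eq0 sy sgr_eq0.
Qed.

(** Near a nonzero [x] the sign [s] is constant and $|y|=sy$, so the function coincides there with a
    smooth one. *)
Lemma is_derive_damped (a b x : R) : x != 0 ->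
  is_derive x 1 (damped a b)
    (Num.sg x * damped (b - a / alpha) (- (b / alpha)) x).
Proof.
move=> x0; pose s := Num.sg x.
have ds (c : R) : is_derive x 1 ( *%R c) c.
  have := @is_deriveZ R R R id c x 1 1 (is_derive_id _ _).
  by rewrite [c *: 1]mulr1.
have d1 : is_derive x 1 (cst a + *%R (b * s)) (b * s).
  have := @is_deriveD R R R (cst a) _ x 1 _ _ (is_derive_cst _ _ _) (ds (b * s)).
  by rewrite add0r.
have d2 := @is_derive1_comp R expR ( *%R (- (s / alpha))) x _ _
  (is_derive_expR _) (ds _).
have := is_deriveM d1 d2.
set g := (_ * _ : R -> R) => dg.
have gE : \near x, g x = damped a b x.
  apply: filterS (sgr_near x0) => y yx.
  rewrite [g y](_ : _ = (a + b * s * y) * expR (- (s / alpha) * y))//.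
  by rewrite /damped normrEsg yx -/s; congr (_ * expR _); ring.
apply: is_derive_eq (near_eq_is_derive gE dg) _.
rewrite /damped normrEsg -/s.
have -> : - (s * x / alpha) = - (s / alpha) * x by ring.
have s2 : s * s = 1 by rewrite /s -expr2 sqr_sg x0.
set E := expR _.
transitivity ((a + b * s * x) * (E * - (s / alpha)) + E * (b * s)) => //.
by ring: s2.
Qed.

Lemma is_derive_sgr_damped (a b x : R) : x != 0 ->
  is_derive x 1 (fun y => Num.sg y * damped a b y)
    (damped (b - a / alpha) (- (b / alpha)) x).
Proof.
move=> x0.
have := @is_deriveZ R R R _ (Num.sg x) x 1 _ (is_derive_damped a b x0).
rewrite [_ *: _]mulrA -expr2 sqr_sg x0 mul1r; apply: near_eq_is_derive.
by apply: filterS (sgr_near x0) => y ->.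
Qed.

(** The complement of 0 is open, so the junk value of a derivative at 0 does not influence further
    derivatives elsewhere. *)
Lemma derive1_off0 (f g : R -> R) (x : R) :
  (forall y, y != 0 -> f y = g y) -> x != 0 -> derive1 f x = derive1 g x.
Proof.
move=> fg x0; rewrite !derive1E; apply: near_eq_derive.
by apply: filterS (near_neq0 x0) => y; exact: fg.
Qed.

(** This is $1-e^{-h}\le h$ with $h=z-y$, multiplied by $e^{-y}$. The decaying factor is kept
    because it later compensates the growth of an affine coefficient. *)
Lemma expRN_lip {y z : R} : 0 <= y -> y <= z ->
  0 <= expR (- y) - expR (- z) <= expR (- y) * (z - y).
Proof.
move=> y0 yz.
have -> : expR (- z) = expR (- y) * expR (- (z - y)).
  by rewrite -expRD; congr expR; ring.
have h1 := expR_ge1Dx (- (z - y)).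
have h2 : expR (- (z - y)) <= 1 by rewrite -expR0 ler_expR oppr_le0 subr_ge0.
have h3 := expR_ge0 (- y).
rewrite -{1 3}[expR (- y)]mulr1 -mulrBr mulr_ge0 ?subr_ge0//=.
by rewrite ler_wpM2l//; lra.
Qed.

Lemma id_expRN_le1 (y : R) : y * expR (- y) <= 1.
Proof.
rewrite expRN ler_pdivrMr ?expR_gt0// mul1r.
by apply: le_trans (expR_ge1Dx _); rewrite lerDr.
Qed.

Lemma affine_expRN_bounded (a b : R) {y : R} : 0 <= y ->
  `|(a + b * y) * expR (- y)| <= `|a| + `|b|.
Proof.
move=> y0; rewrite mulrDl -mulrA; apply: le_trans (ler_normD _ _) _.
have E0 := expR_ge0 (- y).
rewrite !normrM (ger0_norm E0) (ger0_norm y0); apply: lerD.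
  by rewrite ler_piMr// -expR0 ler_expR oppr_le0.
by rewrite ler_piMr// id_expRN_le1.
Qed.

Lemma affine_expRN_lipschitz (a b : R) {y z : R} : 0 <= y -> 0 <= z ->
  `|(a + b * y) * expR (- y) - (a + b * z) * expR (- z)| <=
  (`|a| + 2 * `|b|) * `|y - z|.
Proof.
wlog yz : y z / y <= z.
  move=> H y0 z0; have [/H->//|/ltW/H H'] := leP y z.
  by rewrite distrC [`|y - z|]distrC H'.
move=> y0 z0; have /andP[h1 h2] := expRN_lip y0 yz.
have zy : 0 <= z - y by rewrite subr_ge0.
rewrite [`|y - z|]distrC (ger0_norm zy).
have -> : (a + b * y) * expR (- y) - (a + b * z) * expR (- z) =
  (a + b * y) * (expR (- y) - expR (- z)) - b * (expR (- z) * (z - y)) by ring.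
apply: le_trans (ler_normB _ _) _; rewrite !normrM (ger0_norm h1) (ger0_norm zy).
rewrite (ger0_norm (expR_ge0 _)).
have h3 : expR (- z) * (z - y) <= z - y.
  by rewrite ler_piMl// -expR0 ler_expR oppr_le0.
have h4 : `|a + b * y| * (expR (- y) - expR (- z)) <= (`|a| + `|b|) * (z - y).
  apply: le_trans (_ : `|(a + b * y) * expR (- y)| * (z - y) <= _).
    by rewrite normrM (ger0_norm (expR_ge0 _)) -mulrA ler_wpM2l.
  by rewrite ler_wpM2r// affine_expRN_bounded.
apply: le_trans (lerD h4 (ler_wpM2l (normr_ge0 b) h3)) _.
by rewrite le_eqVlt; apply/orP; left; apply/eqP; ring.
Qed.

(** The estimates for $(a+by)e^{-y}$ are applied at $y=|x|/\alpha$, a function of $x$ with Lipschitz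
    constant $1/\alpha$. *)
Lemma damped_bounded_lipschitz (a b : R) : exists C : R,
  (forall x, `|damped a b x| <= C) /\
  (forall x y, `|damped a b x - damped a b y| <= C * `|x - y|).
Proof.
have dE x : damped a b x =
    (a + (b * alpha) * (`|x| / alpha)) * expR (- (`|x| / alpha)).
  by rewrite /damped -mulrA [alpha * _]mulrC mulfVK// gt_eqF.
have na (x : R) : 0 <= `|x| / alpha by rewrite divr_ge0// ltW.
pose C : R := `|a| + 2 * `|b * alpha|.
have C0 : 0 <= C by rewrite addr_ge0// mulr_ge0.
have Ca0 : 0 <= C / alpha by rewrite divr_ge0// ltW.
exists (C + C / alpha); split=> [x|x y].
  rewrite dE; apply: le_trans (affine_expRN_bounded _ _ (na x)) _.
  apply: le_trans (_ : C <= _); last by rewrite lerDl.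
  by rewrite lerD2l ler_peMl// ler1n.
rewrite !dE; apply: le_trans (affine_expRN_lipschitz _ _ (na x) (na y)) _.
rewrite -/C -mulrBl normrM [`|alpha^-1|]ger0_norm ?invr_ge0 ?(ltW alpha_gt0)//.
rewrite mulrA mulrAC; apply: ler_pM => //.
  by rewrite lerDr.
exact: ler_dist_dist.
Qed.

Lemma KfunE : Kfun alpha = damped (4 * alpha)^-1 (4 * alpha ^+ 2)^-1.
Proof.
apply/funext => x; rewrite /Kfun /damped; congr (_ * _).
by field; rewrite gt_eqF.
Qed.

(** This is the even factor $k$ in $K'''=\mathrm{sgn}\cdot k$; unlike $K'''$ it extends continuously
    through 0. *)
Definition kernel3 := damped (2 * alpha ^+ 4)^-1 (- (4 * alpha ^+ 5)^-1).

Lemma Kfun3E (x : R) : x != 0 -> Kfun3 alpha x = Num.sg x * kernel3 x.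
Proof.
have a0 : alpha != 0 by rewrite gt_eqF.
move=> x0; rewrite /Kfun3 KfunE /derive1n /=.
(* [d1] and [d2] are $K'$ and $K''$ away from 0, obtained by iterating the rule
   $(a,b)\mapsto(b-a/\alpha,-b/\alpha)$. *)
pose d1 := fun y => Num.sg y * damped 0 (- (4 * alpha ^+ 3)^-1) y.
pose d2 := damped (- (4 * alpha ^+ 3)^-1) (4 * alpha ^+ 4)^-1.
have E1 y : y != 0 ->
    derive1 (damped (4 * alpha)^-1 (4 * alpha ^+ 2)^-1) y = d1 y.
  move=> y0; rewrite derive1E (derive_val (is_derive := is_derive_damped _ _ y0)).
  by congr (_ * damped _ _ _); field.
have E2 y : y != 0 -> derive1 d1 y = d2 y.
  move=> y0; rewrite derive1E.
  rewrite (derive_val (is_derive := is_derive_sgr_damped _ _ y0)).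
  by congr (damped _ _ _); field.
rewrite (@derive1_off0 _ d2)//; last first.
  by move=> y y0; rewrite (derive1_off0 E1)// E2.
rewrite derive1E (derive_val (is_derive := is_derive_damped _ _ x0)).
by congr (_ * damped _ _ _); field.
Qed.

Lemma kernel3_at0_ge0 : 0 <= kernel3 0.
Proof.
rewrite /kernel3 /damped normr0 mulr0 addr0 mulr_ge0 ?expR_ge0//.
by rewrite invr_ge0 mulr_ge0// exprn_ge0// ltW.
Qed.

Lemma kernel3N (x : R) : kernel3 (- x) = kernel3 x.
Proof. by rewrite /kernel3 /damped normrN. Qed.

End damped.

(** * The extended vector field *)

Section positivity.
Variable R : realType.

(** Before the first time [s] at which positivity fails, $|g|=g$ and so $e^{Ct}g$ is nondecreasing.
    Its value at [s] is then at least $g(0)>0$, a contradiction. *)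
Lemma half_line_derive_gt0 (g d : R -> R) (C : R) :
  half_line_derive g d -> (forall t : R, 0 < t -> - (C * `|g t|) <= d t) ->
  0 < g 0 -> forall t : R, 0 <= t -> 0 < g t.
Proof.
move=> [cg dg] gd g0 t1 t10; rewrite ltNge; apply/negP => gt1.
pose E : set R := [set t | 0 <= t /\ g t <= 0].
have infE : has_inf E by split; [exists t1|exists 0 => t []].
pose s := inf E.
have s0 : 0 <= s by apply: lb_le_inf; [exact: infE.1|move=> t []].
have before (t : R) : 0 <= t -> t < s -> 0 < g t.
  move=> t0 ts; rewrite ltNge; apply/negP => gt.
  by have := ge_inf infE.2 (conj t0 gt : E t); rewrite leNgt ts.
(* Otherwise continuity would keep [g] positive just after [s], where the infimum produces points of
   [E]. *)
have gs : g s <= 0.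
  rewrite leNgt; apply/negP => gs.
  have /subspace_continuousP/(_ _ s0)/cvgr_gt/(_ _ gs) := cg.
  rewrite near_withinE => /nbhs_ballP[e /= e0 He].
  have [t Et ts] := inf_adherent e0 infE.
  have st : s <= t by apply: ge_inf => //; exact: infE.2.
  have /He/(_ Et.1) : ball s e t.
    by rewrite -ball_normE/= distrC ger0_norm ?subr_ge0// ltrBlDl.
  by rewrite /= ltNge Et.2.
have s_gt0 : 0 < s.
  by rewrite lt_neqAle s0 andbT; apply: contraTneq gs => <-; rewrite -ltNge.
pose u := (fun t => 1 * expR (C * t)) \* g.
have [cE dE] := half_line_derive_expR 1 C.
have cu : {within `[0, s], continuous u}.
  have sub : `[0, s] `<=` @Rplus R by move=> t /=; rewrite in_itv/= => /andP[].
  apply: (continuous_subspaceW sub) => t.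
  by apply: continuousM; [exact: cE|exact: cg].
have du (t : R) : 0 < t -> is_derive t 1 u (expR (C * t) * (d t + C * g t)).
  move=> t0; have h1 := dE _ t0; have h2 := dg _ t0.
  by apply: is_derive_eq (is_deriveM h1 h2) _; rewrite /GRing.scale/=; ring.
have : u 0 <= u s.
  apply: (@ger0_derive1_ndecr R u 0 s) => // t; rewrite in_itv/= => /andP[t0 ts].
    by have [] := du t t0.
  rewrite derive1E (derive_val (is_derive := du t t0)) mulr_ge0 ?expR_ge0//.
  have gt0 := before t (ltW t0) ts.
  by have := gd t t0; rewrite (ger0_norm (ltW gt0)); lra.
rewrite /u/= mulr0 expR0 !mul1r => /(lt_le_trans g0).
by rewrite pmulr_rgt0 ?expR_gt0// ltNge gs.
Qed.

Lemma adjacent_increasing (N : nat) (x : 'I_N -> R) :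
  (forall i j : 'I_N, j = i.+1 :> nat -> x i < x j) ->
  forall i j : 'I_N, (i < j)%N -> x i < x j.
Proof.
move=> adj i j; have [n] := ubnP (j - i); elim: n j => // n IHn j jin ij.
have [ji|ji] := eqVneq (j : nat) i.+1; first exact: adj.
have ltj : (j.-1 < N)%N by apply: leq_ltn_trans (leq_pred _) (ltn_ord j).
have jS : j = (Ordinal ltj).+1 :> nat by rewrite /= prednK// (leq_ltn_trans _ ij).
apply: lt_trans (adj _ _ jS); apply: IHn.
  by rewrite jS subSn in jin; [exact: jin|rewrite -ltnS -jS].
rewrite ltn_neqAle -ltnS -jS ij andbT.
by apply: contra ji => /eqP ->; rewrite -jS.
Qed.

End positivity.

Section velocity.
Variables (R : realType) (alpha : R).
Hypothesis alpha_gt0 : 0 < alpha.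
Variables (N : nat) (w : 'I_N -> {nonneg R}).

Definition potential (x : 'I_N -> R) (i : 'I_N) : R :=
  \sum_(j < N) (w j)%:num * Kfun alpha (x i - x j).

Definition order_sign (i j : 'I_N) : R :=
  if (j < i)%N then 1 else if (i < j)%N then -1 else 0.

(* On increasing configurations [order_sign i j] is the sign of [x i - x j];
   freezing it makes the interaction Lipschitz across collisions. *)
Definition force (x : 'I_N -> R) (i : 'I_N) : R :=
  \sum_(j < N) (w j)%:num * (order_sign i j * kernel3 alpha (x i - x j)).

Definition velocity (x : 'I_N -> R) (i : 'I_N) : R :=
  potential x i ^+ 2 * force x i.

(** Terms with [j != i] have nonzero arguments of sign [order_sign i j]. The excluded diagonal term
    is matched by [order_sign i i = 0]. *)
Lemma ode_rhsE (x : 'rV[R]_N) (i : 'I_N) : increasing_config x ->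
  ode_rhs alpha w x i = velocity (x ord0) i.
Proof.
move=> xinc; rewrite /ode_rhs /velocity /potential /force; congr (_ * _).
rewrite big_mkcond/=; apply: eq_bigr => j _; rewrite /order_sign.
have [ji|ij|/val_inj ->] := ltngtP j i; last by rewrite eqxx mul0r mulr0.
- rewrite neq_ltn ji/= Kfun3E ?subr_eq0 ?gt_eqF ?xinc//.
  by rewrite gtr0_sg// subr_gt0 xinc.
- rewrite neq_ltn ij orbT/= Kfun3E ?subr_eq0 ?lt_eqF ?xinc//.
  by rewrite ltr0_sg// subr_lt0 xinc.
Qed.

Let W : R := \sum_(j < N) (w j)%:num.

Let W_ge0 : 0 <= W.
Proof. by apply: sumr_ge0. Qed.

Lemma weighted_sum_ge (f : 'I_N -> R) (c : R) :
  (forall j, - c <= f j) -> - (W * c) <= \sum_(j < N) (w j)%:num * f j.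
Proof.
by move=> fc; rewrite -mulrN mulr_suml; apply: ler_sum => j _; rewrite ler_wpM2l.
Qed.

Lemma weighted_sum_norm (f : 'I_N -> R) (c : R) :
  (forall j, `|f j| <= c) -> `|\sum_(j < N) (w j)%:num * f j| <= W * c.
Proof.
move=> fc; apply: le_trans (ler_norm_sum _ _ _) _; rewrite mulr_suml.
by apply: ler_sum => j _; rewrite normrM ger0_norm// ler_wpM2l.
Qed.

Lemma norm_order_sign_le1 i j : `|order_sign i j| <= 1.
Proof.
rewrite /order_sign; case: ifP => _; first by rewrite normr1.
by case: ifP => _; rewrite ?normrN1 ?normr0.
Qed.

(** A one-sided bound on [b - b'] suffices because it is multiplied by the nonnegative [a' ^+ 2].
    This costs $A^2\delta$, and the change of the square costs $2A^2\delta$. *)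
Lemma sqr_mul_ge (A delta a a' b b' : R) : 0 <= delta ->
  `|a| <= A -> `|a'| <= A -> `|b| <= A ->
  `|a - a'| <= delta -> - delta <= b - b' ->
  - (3 * A ^+ 2 * delta) <= a ^+ 2 * b - a' ^+ 2 * b'.
Proof.
move=> d0 aA a'A bA aa' bb'.
have A0 : 0 <= A by apply: le_trans aA.
have -> : a ^+ 2 * b - a' ^+ 2 * b' =
  (a - a') * ((a + a') * b) + a' ^+ 2 * (b - b') by ring.
have h1 : `|(a - a') * ((a + a') * b)| <= delta * (2 * A * A).
  rewrite !normrM ler_pM// ler_pM//.
  by apply: le_trans (ler_normD _ _) _; lra.
have h2 : a' ^+ 2 <= A ^+ 2.
  by rewrite -[a' ^+ 2]real_normK ?num_real// lerXn2r// nnegrE.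
have h3 : - (A ^+ 2 * delta) <= a' ^+ 2 * (b - b').
  apply: le_trans (_ : - (a' ^+ 2 * delta) <= _).
    by rewrite lerN2 ler_wpM2r.
  by rewrite -mulrN ler_wpM2l// sqr_ge0.
by move: h1; rewrite ler_norml => /andP[h1 _]; lra.
Qed.

Variable C : R.
Hypothesis K_bounded : forall x, `|Kfun alpha x| <= C.
Hypothesis K_lipschitz : forall x y,
  `|Kfun alpha x - Kfun alpha y| <= C * `|x - y|.
Hypothesis k_bounded : forall x, `|kernel3 alpha x| <= C.
Hypothesis k_lipschitz : forall x y,
  `|kernel3 alpha x - kernel3 alpha y| <= C * `|x - y|.

Let A := W * C.

Let C_ge0 : 0 <= C.
Proof. by apply: le_trans (K_bounded 0). Qed.

Let A_ge0 : 0 <= A.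
Proof. by rewrite mulr_ge0// W_ge0. Qed.

Lemma potential_bounded x i : `|potential x i| <= A.
Proof. exact: weighted_sum_norm. Qed.

Lemma force_bounded x i : `|force x i| <= A.
Proof.
apply: weighted_sum_norm => j; rewrite normrM -[leRHS]mul1r.
by rewrite ler_pM// norm_order_sign_le1.
Qed.

Lemma velocity_bounded x i : `|velocity x i| <= A ^+ 3.
Proof.
rewrite /velocity normrM normrX [A ^+ 3]exprSr.
rewrite ler_pM ?exprn_ge0// ?force_bounded//.
by rewrite lerXn2r ?nnegrE// potential_bounded.
Qed.

Lemma velocity_lipschitz (x y : 'I_N -> R) (e : R) :
  (forall i, `|x i - y i| <= e) ->
  forall i, `|velocity x i - velocity y i| <= (6 * A ^+ 3 + 1) * e.
Proof.
move=> xy i.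
have e0 : 0 <= e by apply: le_trans (xy i).
have xyd j : `|(x i - x j) - (y i - y j)| <= 2 * e.
  have -> : x i - x j - (y i - y j) = (x i - y i) - (x j - y j) by ring.
  by apply: le_trans (ler_normB _ _) _; have := xy i; have := xy j; lra.
have dK : `|potential x i - potential y i| <= A * (2 * e).
  rewrite /potential -sumrB; under eq_bigr do rewrite -mulrBr.
  rewrite /A -mulrA; apply: weighted_sum_norm => j.
  by apply: le_trans (K_lipschitz _ _) _; rewrite ler_wpM2l.
have dk : `|force x i - force y i| <= A * (2 * e).
  rewrite /force -sumrB; under eq_bigr do rewrite -!mulrBr.
  rewrite /A -mulrA; apply: weighted_sum_norm => j.
  rewrite normrM -[leRHS]mul1r ler_pM ?norm_order_sign_le1//.
  by apply: le_trans (k_lipschitz _ _) _; rewrite ler_wpM2l.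
have d0 : 0 <= A * (2 * e) by rewrite mulr_ge0 ?A_ge0// mulr_ge0.
(* The summand 1 only makes the Lipschitz constant strictly positive. *)
have E : 3 * A ^+ 2 * (A * (2 * e)) <= (6 * A ^+ 3 + 1) * e.
  by rewrite -subr_ge0 [leRHS](_ : _ = e)//; ring.
apply: le_trans E; rewrite ler_norml; apply/andP; split.
  apply: sqr_mul_ge; rewrite ?potential_bounded ?force_bounded//.
  by move: dk; rewrite ler_norml => /andP[].
rewrite -lerN2 opprB; apply: sqr_mul_ge; rewrite ?potential_bounded ?force_bounded//.
  by rewrite distrC.
by move: dk; rewrite distrC ler_norml => /andP[].
Qed.

(** A particle other than the neighbours [i] and [j] acts on both with the same frozen sign, so
    Lipschitz continuity of $k$ bounds the difference of its two contributions. Only the mutual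
    interaction needs the sign of $k(0)$. *)
Lemma velocity_gap (x : 'I_N -> R) (i j : 'I_N) : j = i.+1 :> nat ->
  - (3 * A ^+ 3 * `|x j - x i|) <= velocity x j - velocity x i.
Proof.
move=> ji.
have -> : 3 * A ^+ 3 * `|x j - x i| = 3 * A ^+ 2 * (A * `|x j - x i|) by ring.
apply: sqr_mul_ge; rewrite ?potential_bounded ?force_bounded//.
- by rewrite mulr_ge0 ?A_ge0.
- rewrite /potential -sumrB; under eq_bigr do rewrite -mulrBr.
  rewrite /A -mulrA; apply: weighted_sum_norm => l.
  apply: le_trans (K_lipschitz _ _) _; rewrite ler_wpM2l//.
  by rewrite (_ : _ - _ = x j - x i)//; ring.
rewrite /force -sumrB; under eq_bigr do rewrite -mulrBr.
rewrite /A -mulrA; apply: weighted_sum_ge => l.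
have kd (a b : R) : `|a - b| = `|x j - x i| ->
    - (C * `|x j - x i|) <= kernel3 alpha a - kernel3 alpha b.
  by move=> <-; have := k_lipschitz a b; rewrite ler_norml => /andP[].
have k0 : - (C * `|x j - x i|) <= kernel3 alpha (x j - x i).
  have k00 := kernel3_at0_ge0 alpha_gt0.
  have := kd (x j - x i) 0; rewrite subr0 => /(_ erefl) /le_trans; apply.
  by rewrite lerBlDr lerDl.
rewrite /order_sign ji !ltnS.
(* For [l] below [i] or above [j] the signs cancel into a difference of kernels. For [l = j] and
   [l = i] one term vanishes and, by evenness of $k$, the other is $k(x_j-x_i)$. *)
have [li|il|il] := ltngtP l i.
- rewrite !mul1r; apply: kd.
  by congr `|_|; ring.
- rewrite mulN1r opprK; have [jl|lj] := ltnP i.+1 l.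
    rewrite mulN1r [leRHS]addrC; apply: kd.
    by rewrite -normrN; congr `|_|; ring.
  have -> : l = j by apply: val_inj; apply/eqP; rewrite /= ji eqn_leq lj.
  by rewrite mul0r add0r -(kernel3N _ (x i - x j)) opprB.
- by rewrite (val_inj il) mul1r mul0r subr0.
Qed.

End velocity.

(** * Global well-posedness of the original system *)

Section estimates.
Variables (R : realType) (alpha : R).
Hypothesis alpha_gt0 : 0 < alpha.
Variables (N : nat) (w : 'I_N -> {nonneg R}).

Lemma velocity_estimates : exists L : R, [/\ 0 < L,
  forall x i, `|velocity alpha w x i| <= L,
  forall (x y : 'I_N -> R) (e : R), (forall i, `|x i - y i| <= e) ->
    forall i, `|velocity alpha w x i - velocity alpha w y i| <= L * e &
  forall (x : 'I_N -> R) (i j : 'I_N), j = i.+1 :> nat ->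
    - (L * `|x j - x i|) <= velocity alpha w x j - velocity alpha w x i].
Proof.
have [C1 [K1 K2]] := damped_bounded_lipschitz alpha_gt0
  (4 * alpha)^-1 (4 * alpha ^+ 2)^-1.
have [C2 [k1 k2]] := damped_bounded_lipschitz alpha_gt0
  (2 * alpha ^+ 4)^-1 (- (4 * alpha ^+ 5)^-1).
have C10 : 0 <= C1 by apply: le_trans (K1 0).
have C20 : 0 <= C2 by apply: le_trans (k1 0).
rewrite -KfunE// in K1 K2.
pose C := C1 + C2; pose A := (\sum_(j < N) (w j)%:num) * C.
have C1C : C1 <= C by rewrite lerDl.
have C2C : C2 <= C by rewrite lerDr.
have A0 : 0 <= A by rewrite mulr_ge0 ?sumr_ge0// addr_ge0.
have A3 : 0 <= A ^+ 3 by rewrite exprn_ge0.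
have hK1 x : `|Kfun alpha x| <= C by apply: le_trans C1C.
have hK2 x y : `|Kfun alpha x - Kfun alpha y| <= C * `|x - y|.
  by apply: le_trans (K2 x y) _; rewrite ler_wpM2r.
have hk1 x : `|kernel3 alpha x| <= C by apply: le_trans C2C; exact: k1.
have hk2 x y : `|kernel3 alpha x - kernel3 alpha y| <= C * `|x - y|.
  by apply: le_trans (k2 x y) _; rewrite ler_wpM2r.
(* This constant dominates [A ^+ 3] and [3 * A ^+ 3], the bounds for the velocity and for the gap,
   and is positive even if [A] is 0. *)
exists (6 * A ^+ 3 + 1); split=> [|x i|x y e xy i|x i j ji].
- by lra.
- by apply: le_trans (velocity_bounded w hK1 hk1 x i) _; rewrite -/A; lra.
- exact: velocity_lipschitz.
- apply: le_trans (velocity_gap alpha_gt0 w hK1 hK2 hk1 hk2 x ji).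
  by rewrite lerN2 ler_wpM2r// -/A; lra.
Qed.

(** A solution takes only increasing values, where the two fields agree. Uniqueness for the extended
    field therefore transfers to the original system. *)
Lemma ode_solution_velocity (x0 : 'rV[R]_N) (y : R -> 'rV[R]_N) :
  ode_solution alpha w x0 y -> forall i,
  half_line_derive (fun t => y t ord0 i)
    (fun t => velocity alpha w (y t ord0) i).
Proof.
move=> [yinc _ dy] i; apply: half_line_derive_within => t t0.
by rewrite -ode_rhsE//; [exact: dy|exact: yinc].
Qed.

Lemma ode_solution_exists (x0 : 'rV[R]_N) : increasing_config x0 ->
  exists y, ode_solution alpha w x0 y.
Proof.
move=> x0inc; have [L [L0 vB vL vgap]] := velocity_estimates.
have [X [X0 dX]] := bounded_ode_existence L0 vB vL (x0 ord0).
have hX i : half_line_derive (X ^~ i) (fun t => velocity alpha w (X t) i).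
  by apply: is_derive_half_line => t; exact: dX.
(* Gaps between neighbours start positive and decay at most exponentially, so the extended flow
   never leaves the region where it solves the original system. *)
have Xinc t : Rplus t -> forall i j : 'I_N, (i < j)%N -> X t i < X t j.
  move=> t0; apply: adjacent_increasing => i j ji; rewrite -subr_gt0.
  apply: (half_line_derive_gt0 (C := L)
    (half_line_deriveD (hX j) (half_line_deriveN (hX i)))) => //.
  - by move=> s s0; exact: vgap.
  - by rewrite /= X0 subr_gt0; apply: x0inc; rewrite ji.
pose y t : 'rV[R]_N := \row_i X t i.
have yX t : y t ord0 = X t by apply/funext => i; rewrite mxE.
have yinc t : Rplus t -> increasing_config (y t).
  by move=> t0 i j ij; rewrite yX; exact: Xinc.
exists y; split=> [//||t i t0].
  by apply/rowP => i; rewrite yX X0.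
rewrite ode_rhsE//; last exact: yinc.
apply: is_derive_is_derive_within.
rewrite yX (_ : (fun s => _) = X ^~ i); first exact: dX.
by apply/funext => s; rewrite yX.
Qed.

Lemma ode_solution_unique (x0 : 'rV[R]_N) (y z : R -> 'rV[R]_N) :
  ode_solution alpha w x0 y -> ode_solution alpha w x0 z ->
  forall t, Rplus t -> y t = z t.
Proof.
move=> hy hz t t0; have [L [L0 vB vL _]] := velocity_estimates.
have [[_ y0 _] [_ z0 _]] := (hy, hz).
have E := bounded_ode_uniqueness L0 vB vL
  (u := fun t => y t ord0) (v := fun t => z t ord0)
  (ode_solution_velocity hy) (ode_solution_velocity hz) _ t0.
by apply/rowP => i; rewrite E// y0 z0.
Qed.

End estimates.

(** * Equivalence of the two systems *)

Section finite_integrals.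
Variable R : realType.

Lemma finite_set_measurable (A : set R) : finite_set A -> measurable A.
Proof.
move=> /finite_set_countable; apply: countable_measurable => x.
exact: measurable_set1.
Qed.

Lemma finite_set_measurable_fun d (T : sigmaRingType d) (A : set R)
  (f : R -> T) : finite_set A -> measurable_fun A f.
Proof.
move=> fA _ B _; apply: finite_set_measurable.
exact: sub_finite_set fA.
Qed.

(** By injectivity the points are distinct atoms: the domain is a disjoint union of singletons, and
    the one at [a ord0 i] has mass exactly [w i]. *)
Lemma Rintegral_weighted_dirac (N : nat) (w : 'I_N -> {nonneg R})
    (a : 'rV[R]_N) (P : pred 'I_N) (f : R -> R) :
  injective (a ord0) ->
  \int[weighted_dirac w a]_(z in [set a ord0 i | i in [set i | P i]]) f z =
  \sum_(i < N | P i) (w i)%:num * f (a ord0 i).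
Proof.
move=> inj_a; pose mu : {measure set R -> \bar R} := weighted_dirac w a.
have mu1 i : mu [set a ord0 i] = (w i)%:num%:E.
  rewrite /mu/= /weighted_dirac (bigD1 i)//= big1 ?adde0.
    by rewrite /mscale/= diracE mem_set// mule1.
  move=> j ji; rewrite /mscale/= diracE memNset ?mule0// => /inj_a ij.
  by rewrite ij eqxx in ji.
have -> : [set a ord0 i | i in [set i | P i]] =
    \big[setU/set0]_(i <- enum P) [set a ord0 i].
  apply/seteqP; split=> z.
    move=> [i Pi <-]; rewrite -bigcup_seq; exists i => //=.
    by rewrite mem_enum.
  by rewrite -bigcup_seq => -[i /=]; rewrite mem_enum => Pi ->; exists i.
rewrite /Rintegral integral_bigsetU_EFin//=; last first.
- have fD : finite_set (\big[setU/set0]_(i <- enum P) [set a ord0 i]).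
    by rewrite -bigcup_seq; exact: bigcup_finite.
  exact: finite_set_measurable_fun.
- by move=> i j _ _ [z [/= -> /inj_a]].
- exact: enum_uniq.
have int1 i : (\int[weighted_dirac w a]_(z in [set a ord0 i]) (f z)%:E)%E =
    ((w i)%:num * f (a ord0 i))%:E.
  rewrite (@eq_integral _ _ _ mu _ (cst (f (a ord0 i))%:E)) => [|z /set_mem -> //].
  by rewrite integral_cst// mu1 -EFinM mulrC.
by rewrite big_enum/= (eq_bigr _ (fun i _ => int1 i)) sumEFin.
Qed.

End finite_integrals.

Lemma increasing_config_inj (R : realType) (N : nat) (x : 'rV[R]_N) :
  increasing_config x -> injective (x ord0).
Proof.
move=> xinc i j xij; apply: val_inj => /=.
by have [/xinc|/xinc|//] := ltngtP i j; rewrite xij ltxx.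
Qed.

Lemma increasing_config_ltP (R : realType) (N : nat) (x : 'rV[R]_N)
  (i j : 'I_N) : increasing_config x -> (x ord0 i < x ord0 j) = (i < j)%N.
Proof.
move=> xinc; have [ij|ji|/val_inj ->] := ltngtP i j; last by rewrite ltxx.
  by rewrite xinc.
by apply/negbTE; rewrite -leNgt ltW// xinc.
Qed.

(** Both values at 0 are limits from the right of the same function. This recovers the equation at
    time 0 from positive times. *)
Lemma within_Rplus_continuous_eq0 (R : realType) (f g : R -> R) :
  {within Rplus, continuous f} -> {within Rplus, continuous g} ->
  (forall t, 0 < t -> f t = g t) -> f 0 = g 0.
Proof.
have right_cvg (h : R -> R) : {within Rplus, continuous h} ->
    h t @[t --> 0^'+] --> h 0.
  have Rplus0 : Rplus (0 : R) by rewrite /Rplus/=.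
  move=> /subspace_continuousP/(_ _ Rplus0) H; apply: cvg_trans H.
  apply: cvg_app => A.
  change ((\forall t \near (0 : R), Rplus t -> A t) ->
    \forall t \near (0 : R), 0 < t -> A t).
  by apply: filterS => t At t0; apply: At; exact: ltW.
move=> /right_cvg cf /right_cvg cg fg.
apply: (cvg_unique _ cf); first exact: norm_hausdorff.
apply: cvg_trans cg; apply: near_eq_cvg.
near=> t; apply/esym/fg; near: t; exact: nbhs_right_gt.
Unshelve. all: by end_near. Qed.

Section equivalence.
Variables (R : realType) (alpha : R).
Hypothesis alpha_gt0 : 0 < alpha.
Variables (N : nat) (w : 'I_N -> {nonneg R}) (x0 : 'rV[R]_N).
Hypothesis x0_incr : increasing_config x0.

Let M : set R := range (x0 ord0).
Let mu : {measure set R -> \bar R} := weighted_dirac w x0.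

Lemma pde_rhsE (y : R -> 'rV[R]_N) (c : R -> R -> R) (i : 'I_N) (t : R) :
  (forall j, c (x0 ord0 j) t = y t ord0 j) ->
  H_ alpha M mu c (x0 ord0 i) t ^+ 2 *
    \int[mu]_(z in M `\ x0 ord0 i) Kfun3 alpha (c (x0 ord0 i) t - c z t) =
  ode_rhs alpha w (y t) i.
Proof.
move=> cy; have inj := increasing_config_inj x0_incr.
have ME : M = [set x0 ord0 j | j in [set j | predT j]].
  by apply/seteqP; split=> z [j _ <-]; exists j.
have MD : M `\ x0 ord0 i = [set x0 ord0 j | j in [set j | j != i]].
  apply/seteqP; split=> z.
    by move=> [[j _ <-] ji]; exists j => //=; apply: contra_notN ji => /eqP ->.
  move=> [j /= ji <-]; split; first by exists j.
  by move=> /inj ij; rewrite ij eqxx in ji.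
rewrite MD /ode_rhs; congr (_ ^+ 2 * _).
  rewrite /H_ ME (Rintegral_weighted_dirac w predT _ inj).
  by apply: eq_bigr => j _; rewrite !cy.
rewrite (Rintegral_weighted_dirac w (fun j => j != i) _ inj).
by apply: eq_bigr => j _; rewrite !cy.
Qed.

(** A trajectory has speed at most [L], and the field is [L]-Lipschitz, so the composition is
    Lipschitz with constant [L * L]. *)
Lemma half_line_velocity_continuous (y : R -> 'I_N -> R) i :
  (forall i, half_line_derive (y ^~ i) (fun t => velocity alpha w (y t) i)) ->
  {within Rplus, continuous (fun t => velocity alpha w (y t) i)}.
Proof.
move=> dy; have [L [L0 vB vL _]] := velocity_estimates alpha_gt0 w.
apply: (@lipschitz_within_continuous _ _ _ (L * L)) => s t s0 t0.
rewrite -mulrA; apply: vL => j.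
by apply: (half_line_derive_lipschitz (dy j)) => // r _; exact: vB.
Qed.

Variables (y : R -> 'rV[R]_N) (c : R -> R -> R).
Hypothesis cy : forall i t, Rplus t -> c (x0 ord0 i) t = y t ord0 i.

Lemma ode_solution_locally_bounded : ode_solution alpha w x0 y ->
  [locally [bounded c q.1 q.2 | q in M `*` Rplus]].
Proof.
move=> ysol; have [L [L0 vB _ _]] := velocity_estimates alpha_gt0 w.
have dy := ode_solution_velocity alpha_gt0 ysol.
have [_ y0 _] := ysol.
move=> [z0 t0] [_ /= t00].
(* The sum dominates every initial position at once, and the second term bounds the displacement up
   to time [t0 + 1]. *)
pose B := \sum_(i < N) `|x0 ord0 i| + L * (t0 + 1).
exists B; split; first exact: num_real.
move=> b Bb; rewrite /within/=.
have : \forall q \near (z0, t0), q.2 < t0 + 1.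
  exists (setT, [set t | t < t0 + 1]) => [|[z t] []//]; split=> /=.
    exact: filterT.
  by apply: lt_nbhsl; rewrite ltrDl.
apply: filterS => -[_ t] /= tt0 [[i _ <-] /= tp].
apply: le_trans (ltW Bb); rewrite cy//.
have := half_line_derive_lipschitz (dy i) (fun r _ => vB _ _) tp (lexx 0).
rewrite y0 subr0 (ger0_norm tp) => dyi.
rewrite -(subrK (x0 ord0 i) (y t ord0 i)); apply: le_trans (ler_normD _ _) _.
rewrite addrC; apply: lerD.
  by rewrite (bigD1 i)//= lerDl sumr_ge0.
by apply: le_trans dyi _; rewrite ler_wpM2l ?ltW.
Qed.

Lemma ode_solution_pde : ode_solution alpha w x0 y ->
  I_ M c /\ pde_solution alpha M mu c.
Proof.
move=> ysol; have dy := ode_solution_velocity alpha_gt0 ysol.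
have [yinc y0 yd] := ysol.
have cd i t : Rplus t -> is_derive_within Rplus (c (x0 ord0 i)) t
    (ode_rhs alpha w (y t) i).
  move=> t0; apply: is_derive_within_eq (yd t i t0) => // s.
  by rewrite inE => s0; rewrite cy.
split; first split.
- exact: ode_solution_locally_bounded.
- move=> t t0; apply: finite_set_measurable_fun.
  exact: finite_image.
- move=> _ [i _ <-]; exists (fun t => velocity alpha w (y t ord0) i); split.
    exact: (@half_line_velocity_continuous (fun t => y t ord0)).
  by move=> t t0; rewrite -ode_rhsE//; [exact: cd|exact: yinc].
- move=> t _ _ t0 [i _ <-] [j _ <-]; rewrite increasing_config_ltP// => ij.
  by rewrite !cy//; exact: yinc.
split=> [_ t [i _ <-] t0|_ [i _ <-]].
  have tp : Rplus t by exact: ltW.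
  rewrite (@pde_rhsE y) => [|j]; last exact: cy.
  by apply/is_derive_within_gt0 => //; exact: cd.
by rewrite cy ?y0// /Rplus/=.
Qed.

Lemma pde_solution_ode : I_ M c -> pde_solution alpha M mu c ->
  ode_solution alpha w x0 y.
Proof.
move=> [_ _ cC1 cinc] [cd c0].
have Mx i : M (x0 ord0 i) by exists i.
have yinc t : Rplus t -> increasing_config (y t).
  by move=> t0 i j ij; rewrite -!cy//; apply: cinc => //; exact: x0_incr.
have y0 : y 0 = x0.
  by apply/rowP => i; rewrite -cy ?c0// /Rplus/=.
have yd i (t : R) : 0 < t ->
    is_derive t 1 (c (x0 ord0 i)) (velocity alpha w (y t ord0) i).
  move=> t0; have tp : Rplus t by exact: ltW.
  rewrite -(ode_rhsE alpha_gt0); last exact: yinc.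
  by rewrite -(@pde_rhsE y c) => [|j]; [exact: cd|exact: cy].
have yE i s : s \in Rplus -> c (x0 ord0 i) s = y s ord0 i.
  by rewrite inE => s0; rewrite cy.
have dy i : half_line_derive (fun t => y t ord0 i)
    (fun t => velocity alpha w (y t ord0) i).
  have [df [_ cdf]] := cC1 _ (Mx i).
  split=> [|t t0].
    apply: (@is_derive_within_continuous _ _ _ df) => t t0.
    by apply: is_derive_within_eq (cdf t t0) => // s; exact: yE.
  apply/is_derive_within_gt0 => //.
  apply: is_derive_within_eq (_ : is_derive_within _ (c (x0 ord0 i)) _ _).
  - exact: yE.
  - exact: ltW.
  - by apply: is_derive_is_derive_within; exact: yd.
split=> // t i t0; rewrite (ode_rhsE alpha_gt0); last exact: yinc.
apply: is_derive_within_eq (_ : is_derive_within _ (c (x0 ord0 i)) _ _) => //.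
  exact: yE.
(* At time 0 the equation for [c] says nothing. The continuous derivative [df] and the velocity
   agree at positive times, hence also at 0. *)
have [t_eq0|t_neq0] := eqVneq t 0; last first.
  apply: is_derive_is_derive_within; apply: yd.
  by rewrite lt_neqAle eq_sym t_neq0.
have [df [cdf ddf]] := cC1 _ (Mx i).
rewrite t_eq0 -(within_Rplus_continuous_eq0 cdf
  (@half_line_velocity_continuous (fun t => y t ord0) i dy)).
  by apply: ddf; rewrite /Rplus/=.
move=> s s0; have ds := yd i s s0.
have /is_derive_within_gt0 -/(_ s0) ds' := ddf s (ltW s0).
by rewrite -(derive_val (is_derive := ds)) (derive_val (is_derive := ds')).
Qed.

End equivalence.

Theorem proposition3p4 (R : realType) (alpha : R) (halpha : 0 < alpha)
    (N : nat) (x0 : 'rV[R]_N) (hx0 : increasing_config x0)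
    (w : 'I_N -> {nonneg R})
    (hw : 0 < \sum_(i < N) (w i)%:num <= 1) :
  let M : set R := range (x0 ord0) in
  let mu : {measure set R -> \bar R} := weighted_dirac w x0 in
  (exists x : R -> 'rV[R]_N,
    [/\ ode_solution alpha w x0 x,
        (forall y : R -> 'rV[R]_N, ode_solution alpha w x0 y ->
           forall t, Rplus t -> y t = x t) &
        (exists c : R -> R -> R,
           [/\ (forall i t, Rplus t -> c (x0 ord0 i) t = x t ord0 i),
               I_ M c,
               pde_solution alpha M mu c &
               forall c' : R -> R -> R, I_ M c' -> pde_solution alpha M mu c' ->
                 forall z t, M z -> Rplus t -> c' z t = c z t])]) /\
  (forall (y : R -> 'rV[R]_N) (c : R -> R -> R),
     (forall i t, Rplus t -> c (x0 ord0 i) t = y t ord0 i) ->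
     (ode_solution alpha w x0 y <->
      (I_ M c /\ pde_solution alpha M mu c))).
Proof.
move=> M mu; split; last first.
  move=> y c cy; split; first exact: ode_solution_pde.
  by move=> [Ic pc]; exact: pde_solution_ode pc.
have [x xsol] := ode_solution_exists halpha w hx0.
exists x; split=> //.
  by move=> y ysol t t0; exact: ode_solution_unique ysol xsol t t0.
(* Since the initial positions are distinct, the sum has exactly one term for [z] in [M]; elsewhere
   it is 0. *)
pose c z t := \sum_(i < N | x0 ord0 i == z) x t ord0 i.
have cx i t : Rplus t -> c (x0 ord0 i) t = x t ord0 i.
  move=> _; rewrite /c (big_pred1 i)// => j.
  by apply/eqP/eqP => [/(increasing_config_inj hx0)|->].
have [Ic pc] := ode_solution_pde halpha hx0 cx xsol.
exists c; split=> // c' Ic' pc' _ t [i _ <-] t0.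
(* A competitor [c'] is read as a trajectory, so that uniqueness for the system applies. *)
pose y t : 'rV[R]_N := \row_i c' (x0 ord0 i) t.
have cy j s : Rplus s -> c' (x0 ord0 j) s = y s ord0 j by rewrite mxE.
have ysol := pde_solution_ode halpha hx0 cy Ic' pc'.
by rewrite cx// cy// (ode_solution_unique halpha ysol xsol).
Qed.
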